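(* Let $N$ be a finite set and let $f : 2^N \to \mathbb{Q}$ be a submodular function with $f(\emptyset)=0$. Let $\pi\in\mathbb{R}^N$ and $\pi_0\in\mathbb{R}$ be such that the inequality $\pi x \le z + \pi_0$ is a non-trivial facet-defining inequality of $\mathcal{Q}_f$. Then $\pi_0 = 0$.
   Context: A set function $f:2^N\to\mathbb{Q}$ is submodular if $f(S\cup T)+f(S\cap T)\le f(S)+f(T)$ for all $S,T\subseteq N$. For $x\in\{0,1\}^N$ write $f(x) := f(\{i\in N: x_i=1\})$. The polyhedron $\mathcal{Q}_f \subseteq \mathbb{R}^N\times\mathbb{R}$ is the convex hull of the epigraph of $f$: $\mathcal{Q}_f := \mathrm{conv}\{(x,z)\in\{0,1\}^N\times\mathbb{R} : f(x)\le z\}$. For $\pi, x\in\mathbb{R}^N$, $\pi x := \sum_{i\in N}\pi_i x_i$. An inequality in $(x,z)$ is valid for $\mathcal{Q}_f$ if every point of $\mathcal{Q}_f$ satisfies it; it is facet-defining if it is valid and the set of points of $\mathcal{Q}_f$ satisfying it with equality is a facet of $\mathcal{Q}_f$ (a proper face of dimension $\dim \mathcal{Q}_f - 1 = |N|$). The trivial inequalities of $\mathcal{Q}_f$ are the variable bounds $0\le x_i$ and $x_i\le 1$, $i\in N$; a facet-defining inequality is non-trivial if it is not a positive multiple of one of these bounds. *)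

(* Defs.v *)
From HB Require Import structures.
From mathcomp Require Import all_boot all_order all_algebra.
From mathcomp Require Import classical_sets reals.

Set Implicit Arguments.
Unset Strict Implicit.
Unset Printing Implicit Defensive.

Import Order.TTheory GRing.Theory Num.Theory.
Local Open Scope classical_set_scope.
Local Open Scope ring_scope.

(* R^N x R.  The regular modules R^o are what give the vectType structure.    *)
Notation point R N := ({ffun N -> R^o} * R^o)%type.

Definition submodular (N : finType) (f : {set N} -> rat) : Prop :=
  forall S T : {set N}, f (S :|: T) + f (S :&: T) <= f S + f T.

Definition conv_hull (R : realType) (V : vectType R) (A : set V) : set V :=
  [set v | exists (n : nat) (l : 'I_n -> R) (p : 'I_n -> V),
     [/\ forall i, 0 <= l i, \sum_i l i = 1, forall i, A (p i)
       & v = \sum_i l i *: p i]].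

Definition aff_hull (R : realType) (V : vectType R) (A : set V) : set V :=
  [set v | exists (n : nat) (l : 'I_n -> R) (p : 'I_n -> V),
     [/\ \sum_i l i = 1, forall i, A (p i) & v = \sum_i l i *: p i]].

(* The affine hull of [A] is a translate of a d-dimensional linear subspace.  *)
(* Such a [d] exists, and is then unique, exactly when [A] is nonempty; the   *)
(* empty set, of conventional dimension -1, satisfies this for no [d].        *)
Definition has_dim (R : realType) (V : vectType R) (A : set V) (d : nat)
    : Prop :=
  exists (p : V) (U : {vspace V}),
    \dim U = d /\ aff_hull A = [set v | v - p \in U].

Definition epigraph (R : realType) (N : finType) (f : {set N} -> rat) :
    set (point R N) :=
  [set v : point R N |
     (forall i, v.1 i = 0 \/ v.1 i = 1)
     /\ ratr (f [set i | v.1 i == 1]%SET) <= v.2].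
Arguments epigraph R {N} f _.

Definition Qpoly (R : realType) (N : finType) (f : {set N} -> rat) :
    set (point R N) :=
  conv_hull (epigraph R f).
Arguments Qpoly R {N} f _.

Definition dot (R : realType) (N : finType) (a x : {ffun N -> R^o}) : R :=
  \sum_i a i * x i.

(* The triple ((a, b), c) encodes the inequality  a x + b z <= c.             *)
Notation inequality R N := (point R N * R^o)%type.

Definition satisfies (R : realType) (N : finType) (q : inequality R N)
    (v : point R N) : Prop :=
  dot q.1.1 v.1 + q.1.2 * v.2 <= q.2.

Definition tight (R : realType) (N : finType) (q : inequality R N) :
    set (point R N) :=
  [set v | dot q.1.1 v.1 + q.1.2 * v.2 = q.2].

Definition valid (R : realType) (N : finType) (Q : set (point R N))
    (q : inequality R N) : Prop :=
  forall v, Q v -> satisfies q v.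

Definition facet_defining (R : realType) (N : finType) (Q : set (point R N))
    (q : inequality R N) : Prop :=
  let F := Q `&` tight q in
  [/\ valid Q q, F !=set0, F <> Q
    & exists d : nat, has_dim Q d.+1 /\ has_dim F d].

Definition unit_vec (R : realType) (N : finType) (i : N) : {ffun N -> R^o} :=
  [ffun j => (j == i)%:R].

(* 0 <= x_i, in the form  - x_i <= 0 *)
Definition lower_bound (R : realType) (N : finType) (i : N) : inequality R N :=
  ((- unit_vec R i, 0), 0).

Definition upper_bound (R : realType) (N : finType) (i : N) : inequality R N :=
  ((unit_vec R i, 0), 1).

Definition trivial_ineq (R : realType) (N : finType) (q : inequality R N)
    : Prop :=
  exists (i : N) (t : R),
    0 < t /\ (q = t *: lower_bound R i \/ q = t *: upper_bound R i).

(* pi x <= z + pi0, in the form  pi x - z <= pi0 *)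
Definition polymatroid_ineq (R : realType) (N : finType)
    (pi : {ffun N -> R^o}) (pi0 : R) : inequality R N :=
  ((pi, -1), pi0).

(* Main.v *)
(** Put [g S = f S - pi(S)], a submodular function with [g set0 = 0].  Validity
    says that [- pi0] is a lower bound of [g], and the sets [S] with
    [g S = - pi0] are those carrying points of the face; they are closed under
    intersection.  If [pi0 != 0], a smallest such set [S] is nonempty and is
    contained in all the others, so for any [i] in [S] the face lies in the
    hyperplane [x_i = 1] as well as in [pi x - z = pi0].  Since the polyhedron
    contains segments in a vertical direction and segments on which [x_i]
    varies, such a face has codimension at least 2. *)

Require Import Defs.
From HB Require Import structures.
From mathcomp Require Import all_boot all_order all_algebra.
From mathcomp Require Import classical_sets reals.
From mathcomp Require Import ring lra.
Local Open Scope ring_scope.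

Set Implicit Arguments.
Unset Strict Implicit.
Unset Printing Implicit Defensive.

Import Order.TTheory GRing.Theory Num.Theory.

Section Hulls.
Variables (R : realType) (V : vectType R).
Implicit Types (A B : set V) (U : {vspace V}) (phi psi : {scalar V}).

Lemma sub_conv_hull A : (A `<=` conv_hull A)%classic.
Proof.
move=> v Av; exists 1%N, (fun=> 1), (fun=> v).
by split=> //; rewrite big_ord1 ?scale1r.
Qed.

Lemma sub_aff_hull A : (A `<=` aff_hull A)%classic.
Proof.
move=> v Av; exists 1%N, (fun=> 1), (fun=> v).
by split=> //; rewrite big_ord1 ?scale1r.
Qed.

Lemma aff_hull_const A phi c :
  (forall v, A v -> phi v = c) -> forall v, aff_hull A v -> phi v = c.
Proof.
move=> Ac v [n [l [p [l1 Ap ->]]]].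
rewrite linear_sum -[RHS]mul1r -l1 mulr_suml.
by apply: eq_bigr => i _; rewrite linearZ /= Ac.
Qed.

Lemma aff_hull_direction A p U a b :
  aff_hull A = [set v | v - p \in U]%classic -> A a -> A b -> a - b \in U.
Proof.
move=> eqA /sub_aff_hull + /sub_aff_hull; rewrite eqA /= => Ua Ub.
by have := rpredB Ua Ub; rewrite opprB addrA subrK.
Qed.

Lemma direction_const A p U phi c u :
  aff_hull A = [set v | v - p \in U]%classic ->
  (forall v, A v -> phi v = c) -> u \in U -> phi u = 0.
Proof.
move=> eqA Ac Uu.
have pc : phi p = c by apply: (aff_hull_const Ac); rewrite eqA /= subrr mem0v.
have upc : phi (u + p) = c by apply: (aff_hull_const Ac); rewrite eqA /= addrK.
by apply: (@addIr _ (phi p)); rewrite add0r -linearD upc pc.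
Qed.

(** The weighted slacks [l j * (c - phi (p j))] are nonnegative and sum to zero, so each of them
    vanishes. *)
Lemma conv_hull_face A phi c n (l : 'I_n -> R) (p : 'I_n -> V) :
    (forall v, A v -> phi v <= c) ->
    (forall i, 0 <= l i) -> \sum_i l i = 1 -> (forall i, A (p i)) ->
    phi (\sum_i l i *: p i) = c ->
  forall i, l i != 0 -> phi (p i) = c.
Proof.
move=> Ac l0 l1 Ap pc i li.
have s0 : \sum_j l j * (c - phi (p j)) = 0.
  rewrite -[in LHS]pc linear_sum /=.
  under eq_bigr do rewrite mulrBr.
  rewrite sumrB -mulr_suml l1 mul1r; apply/eqP; rewrite subr_eq0; apply/eqP.
  by apply: eq_bigr => j _; rewrite linearZ.
have := psumr_eq0P _ s0; move/(_ _ i isT) => /(_ _)/eqP.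
rewrite mulf_eq0 (negPf li) /= subr_eq0 => H; apply/esym/eqP/H => j _.
by rewrite mulr_ge0 // subr_ge0 Ac.
Qed.

(** Both functionals vanish on the direction [U] of [A], which has codimension 1 in the direction
    [W] of [B]. Since [psi] separates [x] from [y], the vector [x - y] completes [U] to [W]; as
    [phi] kills it too, [phi] vanishes on [W], in particular at [z - t]. *)
Lemma codim1_not_two_hyperplanes A B d phi psi b c x y z t :
    has_dim B d.+1 -> has_dim A d -> (A `<=` B)%classic ->
    (forall v, A v -> phi v = b) -> (forall v, A v -> psi v = c) ->
    B x -> B y -> B z -> B t ->
    phi x = phi y -> psi x != psi y -> phi z = phi t.
Proof.
move=> [q [W [dW eqB]]] [p [U [dU eqA]]] AB Ab Ac Bx By Bz Bt xy.
apply: contraNeq => zt.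
have Uphi u : u \in U -> phi u = 0 by apply: direction_const eqA Ab.
have Upsi u : u \in U -> psi u = 0 by apply: direction_const eqA Ac.
have UW : (U <= W)%VS.
  apply/subvP => u Uu.
  have sA : (aff_hull A `<=` aff_hull B)%classic.
    by move=> v [n [l [r [l1 Ar ->]]]]; exists n, l, r; split=> // i; apply: AB.
  have : aff_hull B p by apply: sA; rewrite eqA /= subrr mem0v.
  have : aff_hull B (u + p) by apply: sA; rewrite eqA /= addrK.
  rewrite eqB /= => Wup Wp.
  by have := rpredB Wup Wp; rewrite opprB addrA subrK addrK.
have Wxy : x - y \in W by apply: aff_hull_direction eqB Bx By.
have Wzt : z - t \in W by apply: aff_hull_direction eqB Bz Bt.
have sUxW : (U + <[x - y]> <= W)%VS by rewrite subv_add UW -memvE.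
case: (boolP (x - y \in U)) => [/Upsi/eqP | nUxy].
  by rewrite linearB subr_eq0.
(* Otherwise the sum has dimension at most [d], hence equals [U], and [x - y] would lie in [U]. *)
have dUx : (\dim W <= \dim (U + <[x - y]>))%N.
  rewrite dW -dU ltnNge; apply: contra nUxy => le_dim.
  have /eqP -> : U == (U + <[x - y]>)%VS by rewrite eqEdim addvSl.
  by rewrite memvE addvSr.
have /eqP eqW : (U + <[x - y]>)%VS == W by rewrite eqEdim sUxW.
move: Wzt; rewrite -eqW => /memv_addP [u Uu [v /vlineP [k ->] e]].
case/negP: zt; rewrite -subr_eq0 -linearB e linearD linearZ /= linearB.
by rewrite xy subrr mulr0 addr0 Uphi.
Qed.

End Hulls.

Section Inequalities.
Variables (R : realType) (N : finType).
Implicit Types (q : inequality R N) (v : Defs.point R N).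

Definition lhs q v : R := dot q.1.1 v.1 + q.1.2 * v.2.

Lemma lhs_is_scalar q : scalar (lhs q).
Proof.
move=> k [x z] [y t]; rewrite /lhs /dot /= [in RHS]mulrDr.
rewrite addrACA mulr_sumr -big_split /=; congr (_ + _).
  apply: eq_bigr => i _; rewrite !ffunE.
  by rewrite -[k *: x i]/(k * x i); ring.
by rewrite -[k *: z]/(k * z); ring.
Qed.

HB.instance Definition _ q :=
  GRing.isLinear.Build R (Defs.point R N) R *%R (lhs q) (lhs_is_scalar q).

(** Provides the coordinate [x_i] as a linear functional, for use with the lemmas on hulls. *)
Lemma lhs_upper_bound i v : lhs (upper_bound R i) v = v.1 i.
Proof.
rewrite /lhs /dot /= mul0r addr0 (bigD1 i) //= ffunE eqxx mul1r big1 ?addr0 //.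
by move=> j /negPf ji; rewrite ffunE ji mul0r.
Qed.

Definition indicator (S : {set N}) : {ffun N -> R^o} :=
  [ffun i => (i \in S)%:R].

Lemma dot_indicator (a : {ffun N -> R^o}) S :
  dot a (indicator S) = \sum_(i in S) a i.
Proof.
rewrite /dot [RHS]big_mkcond /=; apply: eq_bigr => i _.
by rewrite ffunE; case: (i \in S); rewrite ?mulr1 ?mulr0.
Qed.

Lemma indicator_support S : [set i | indicator S i == 1]%SET = S.
Proof.
apply/setP => i; rewrite inE ffunE.
by case: (i \in S); rewrite ?eqxx // eq_sym oner_eq0.
Qed.

Lemma epigraph_indicator (f : {set N} -> rat) S (z : R^o) :
  ratr (f S) <= z -> epigraph R f (indicator S, z).
Proof.
move=> fz; split=> /= [i|]; last by rewrite indicator_support.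
by rewrite ffunE; case: (i \in S); [right|left].
Qed.

Lemma epigraphE (f : {set N} -> rat) v :
  epigraph R f v -> exists2 S, v.1 = indicator S & ratr (f S) <= v.2.
Proof.
move=> [v01 fv]; exists [set i | v.1 i == 1]%SET => //.
apply/ffunP => i; rewrite ffunE inE.
by case: (v01 i) => ->; rewrite ?eqxx // eq_sym oner_eq0.
Qed.

End Inequalities.

Section Minimizers.
Variables (R : realType) (N : finType) (g : {set N} -> R) (m : R).

(** The values at the union and at the intersection are both at least [m] and sum to at most
    [m + m]. *)
Lemma minimizerI (S T : {set N}) :
    (forall A B : {set N}, g (A :|: B) + g (A :&: B) <= g A + g B) ->
    (forall A, m <= g A) ->
  g S = m -> g T = m -> g (S :&: T) = m.
Proof.
move=> g_submod g_ge gS gT.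
have := g_submod S T; have := g_ge (S :|: T); have := g_ge (S :&: T).
by rewrite gS gT; lra.
Qed.

(** Take a minimizer [S] of least cardinality: [S :&: T] is again a minimizer, so it cannot be
    smaller than [S]. *)
Lemma least_minimizer (S0 : {set N}) :
    (forall A B : {set N}, g (A :|: B) + g (A :&: B) <= g A + g B) ->
    (forall A, m <= g A) ->
  g S0 = m -> exists2 S, g S = m & forall T, g T = m -> S \subset T.
Proof.
move=> g_submod g_ge /eqP gS0.
case: (@arg_minnP _ S0 (fun S => g S == m) (fun S => #|S|) gS0).
move=> S /eqP gS minS; exists S => // T gT.
apply/finset.setIidPl/eqP; rewrite eqEcard finset.subsetIl minS //.
by apply/eqP/minimizerI.
Qed.

End Minimizers.

Theorem proposition4 (R : realType) (N : finType) (f : {set N} -> rat)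
    (f_submod : submodular f) (f0 : f finset.set0 = 0)
    (pi : {ffun N -> R^o}) (pi0 : R)
    (facet : facet_defining (Qpoly R f) (polymatroid_ineq pi pi0))
    (nontrivial : ~ trivial_ineq (polymatroid_ineq pi pi0)) :
  pi0 = 0.
Proof.
case: facet => validq [v0 [Qv0 tv0]] _ [d [dimQ dimF]].
set q := polymatroid_ineq pi pi0 in validq tv0 dimF.
pose g (S : {set N}) : R := ratr (f S) - \sum_(i in S) pi i.
have QE S (z : R^o) : ratr (f S) <= z -> Qpoly R f (indicator R S, z).
  by move=> /epigraph_indicator; apply: sub_conv_hull.
have lhsE S (z : R^o) : lhs q (indicator R S, z) = \sum_(i in S) pi i - z.
  by rewrite /lhs /= dot_indicator mulN1r.
have g_ge S : - pi0 <= g S.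
  have /validq := QE S _ (lexx _).
  by rewrite /satisfies -/(lhs q _) lhsE /= /g; lra.
have g_submod S T : g (S :|: T)%SET + g (S :&: T)%SET <= g S + g T.
  have := f_submod S T; rewrite -(ler_rat R) !rmorphD /= /g.
  (* The sum of [pi] is modular, so subtracting it preserves submodularity. *)
  have : \sum_(i in S :|: T) pi i + \sum_(i in S :&: T) pi i
       = \sum_(i in S) pi i + \sum_(i in T) pi i :> R.
    rewrite [X in X + _]big_mkcond [X in _ + X]big_mkcond -big_split /=.
    rewrite [X in _ = X + _]big_mkcond [X in _ = _ + X]big_mkcond -big_split /=.
    apply: eq_bigr => i _; rewrite !inE.
    by case: (i \in S); case: (i \in T); rewrite /= ?addr0 ?add0r.
  by lra.
have epi_le v : epigraph R f v -> lhs q v <= pi0.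
  by move=> /sub_conv_hull /validq.
have epi_tight v : epigraph R f v -> lhs q v = pi0 ->
    exists2 S, v.1 = indicator R S & g S = - pi0.
  (* Tightness and [ratr (f S) <= z] give [g S <= - pi0]; [g_ge] gives the converse. *)
  case: v => x z /epigraphE [S /= -> fz]; rewrite lhsE => t; exists S => //.
  by have := g_ge S; rewrite /g; lra.
have [S0 gS0] : exists S, g S = - pi0.
  case: Qv0 tv0 => n [l [p [l0 l1 Ap ->]]] t.
  (* The weights sum to 1, so they cannot all vanish. *)
  have [k lk] : exists k, l k != 0.
    apply/existsP; apply: contra_eqT l1; rewrite negb_exists => /forallP lz.
    rewrite big1 ?(eq_sym 0) ?oner_eq0 // => k _.
    by apply/eqP; rewrite -[_ == _]negbK.
  have [S _ gS] := epi_tight _ (Ap k) (conv_hull_face epi_le l0 l1 Ap t lk).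
  by exists S.
have [S gS leastS] := least_minimizer g_submod g_ge gS0.
have [S_0|[i iS]] := set_0Vmem S.
  by move: gS; rewrite S_0 /g f0 rmorph0 big_set0; lra.
have faceq v : (Qpoly R f `&` tight q)%classic v -> lhs q v = pi0 by case.
have facei v : (Qpoly R f `&` tight q)%classic v -> lhs (upper_bound R i) v = 1.
  move=> [[n [l [p [l0 l1 Ap ->]]]] t].
  rewrite linear_sum /= -[RHS]l1; apply: eq_bigr => k _.
  rewrite linearZ /= lhs_upper_bound.
  (* Only points of nonzero weight need be tight; each of these lies over a minimizer, which
     contains [S] and hence [i]. *)
  have [->|lk] := eqVneq (l k) 0; first by rewrite mul0r.
  have [T -> gT] := epi_tight _ (Ap k) (conv_hull_face epi_le l0 l1 Ap t lk).
  by rewrite ffunE (fintype.subsetP (leastS _ gT)) // mulr1.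
have fS1 : ratr (f S) <= ratr (f S) + 1 :> R by lra.
(* The first two points form a vertical segment over [S], with the same [x_i] but different [lhs q].
   The last two lie over [S] and the empty set, where [x_i] is 1 and 0, so the lemma yields
   [1 = 0]. *)
have := codim1_not_two_hyperplanes dimQ dimF (@subIsetl _ _ _) facei faceq
  (QE S _ (lexx _)) (QE S _ fS1) (QE S _ (lexx _)) (QE finset.set0 _ (lexx _)).
rewrite /= !lhs_upper_bound !lhsE /= !ffunE iS inE => /(_ erefl) H.
suff /H/eqP : \sum_(j in S) pi j - ratr (f S)
            != \sum_(j in S) pi j - (ratr (f S) + 1) by rewrite oner_eq0.
by apply/eqP; lra.
Qed.
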